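(* Let $t_0>0$ and $C\ge0$, let $g:[t_0,+\infty)\to\mathbb{R}^n$ be a continuous function and let $a:[t_0,+\infty)\to[0,+\infty)$ be a continuous function. If $$\left\|g(t)+\int_{t_0}^t a(s)g(s)\,ds\right\|\le C\qquad\text{for all } t\ge t_0,$$ then $$\sup_{t\ge t_0}\|g(t)\|<+\infty.$$
   Context: $\|\cdot\|$ is the Euclidean norm on $\mathbb{R}^n$. *)

(* Defs.v *)
From mathcomp Require Import all_boot all_order all_algebra.
From mathcomp Require Import all_classical all_reals all_analysis.

Set Implicit Arguments.
Unset Strict Implicit.
Unset Printing Implicit Defensive.

Import Order.TTheory GRing.Theory Num.Theory.
Import numFieldNormedType.Exports.
Local Open Scope classical_set_scope.
Local Open Scope ring_scope.

(* The canonical norm `|x| on 'rV[R]_n is the sup norm, hence this definition;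
   both norms induce the canonical topology of 'rV[R]_n. *)
Definition euclidean_norm (R : realType) (n : nat) (x : 'rV[R]_n) : R :=
  Num.sqrt (\sum_(i < n) x ord0 i ^+ 2).

(* Componentwise integral over [a, b], with a <= b. A component that is not
   Lebesgue integrable gets a junk value; this never happens when f is
   continuous on [a, b], and the integral is then the Riemann integral. *)
Definition vec_integral (R : realType) (n : nat) (a b : R) (f : R -> 'rV[R]_n) :
    'rV[R]_n :=
  \row_(i < n) \int[lebesgue_measure]_(s in `[a, b]) f s ord0 i.

(* Main.v *)
(** It suffices to bound each coordinate u of g. Let G t be the integral of a * u
    from t0 to t, so that |u + G| <= C. If G t > C, let c be the last time before
    t at which G c <= C. After c we have u <= C - G < 0, so a * u <= 0 and
    G t <= G c <= C, a contradiction. Thus G <= C; applying this to - u gives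
    |G| <= C, whence |u| <= 2 C. *)
Require Import Defs.
From mathcomp Require Import all_boot all_order all_algebra.
From mathcomp Require Import all_classical all_reals all_analysis.

Set Implicit Arguments.
Unset Strict Implicit.
Unset Printing Implicit Defensive.

Import Order.TTheory GRing.Theory Num.Theory.
Import numFieldNormedType.Exports.
Local Open Scope classical_set_scope.
Local Open Scope ring_scope.

(** The points of the segment where [f] is at most [C] form a nonempty compact set [K]; its greatest
    element serves as [c]. *)
Lemma last_le_segment (R : realType) (f : R -> R) (a b C : R) :
    a <= b -> {within `[a, b], continuous f} -> f a <= C ->
  exists c, [/\ a <= c <= b, f c <= C & forall x, c < x <= b -> C < f x].
Proof.
move=> ab cf faC.
pose K := `[a, b]%classic `&` f @^-1` [set y | y <= C].
have cK : compact K.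
  apply: (subclosed_compact _ (@segment_compact R a b)); last by move=> x [].
  (* Continuity of [f] is relative to the segment. Since the segment is closed, it is enough that
     the preimage be closed in the subspace topology. *)
  rewrite closed_setSI; last exact: interval_closed.
  by apply: preimage_closed; [move=> x _; exact: cf|exact: closed_le].
have K0 : K !=set0 by exists a; split=> //=; rewrite in_itv/= lexx.
(* The extreme value theorem, applied to the identity on [K], gives the greatest element. *)
have cid : {within K, continuous (@idfun R)}.
  by apply: continuous_subspaceT => x; exact: cvg_id.
have [c] := compact_EVT_max K0 cK cid.
rewrite inE => -[/=]; rewrite in_itv/= => acb fcC cmax.
exists c; split=> // x /andP[cx xb]; rewrite ltNge; apply/negP => fxC.
have /cmax : x \in K.
  rewrite inE; split=> //=; rewrite in_itv/= xb andbT.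
  by case/andP: acb => ac _; exact: le_trans ac (ltW cx).
by rewrite leNgt cx.
Qed.

Section scalar_bound.
Variables (R : realType) (t0 C : R) (a : R -> R).
Hypotheses (C_ge0 : 0 <= C) (a_ge0 : forall t, t0 <= t -> 0 <= a t).
Notation mu := (@lebesgue_measure R).

Lemma Rintegral_le_of_sum_le (u : R -> R) :
    (forall t, mu.-integrable `[t0, t] (EFin \o (fun s => a s * u s))) ->
    (forall t, t0 <= t -> u t + \int[mu]_(s in `[t0, t]) (a s * u s) <= C) ->
  forall t, t0 <= t -> \int[mu]_(s in `[t0, t]) (a s * u s) <= C.
Proof.
move=> iau uC t t0t; set G := fun t => \int[mu]_(s in `[t0, t]) (a s * u s).
have cG : {within `[t0, t], continuous G}.
  exact: parameterized_integral_continuous.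
have Gt0 : G t0 <= C by rewrite /G set_itv1 Rintegral_set1.
have [c [/andP[t0c ct] GcC Gx]] := last_le_segment t0t cG Gt0.
(* [G t <= G c] is obtained directly: [G t - G c] is the integral of [a * u] over []c, t]], whose
   integrand is nonpositive. The case [c = t] needs no separate treatment, this interval being
   empty. *)
apply: le_trans GcC; rewrite -/(G t) -subr_le0.
rewrite Rintegral_itvB ?bnd_simp//.
have iau' : mu.-integrable `]c, t] (EFin \o (fun s => a s * u s)).
  apply: integrableS (iau t) => //.
  by apply: subset_itvr; rewrite bnd_simp.
rewrite -oppr_ge0 -mulN1r -RintegralZl//.
apply: Rintegral_ge0 => s /=; rewrite in_itv/= => /andP[cs st].
have t0s : t0 <= s := le_trans t0c (ltW cs).
rewrite mulN1r oppr_ge0 mulr_ge0_le0 ?a_ge0//.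
have := uC _ t0s; rewrite -lerBrDr => /le_trans; apply.
by rewrite subr_le0 ltW// Gx// cs.
Qed.

Lemma normr_le_of_normr_sum_le (u : R -> R) :
    (forall t, mu.-integrable `[t0, t] (EFin \o (fun s => a s * u s))) ->
    (forall t, t0 <= t ->
      `|u t + \int[mu]_(s in `[t0, t]) (a s * u s)| <= C) ->
  forall t, t0 <= t -> `|u t| <= C *+ 2.
Proof.
move=> iau uC t t0t; set I := \int[mu]_(s in `[t0, t]) (a s * u s).
have IC : I <= C.
  apply: Rintegral_le_of_sum_le => // s t0s.
  by have := uC _ t0s; rewrite ler_norml => /andP[].
(* Negation is written as scaling by [-1], so that linearity gives both the integral and the
   integrability of [a * - u]. *)
have auN : (fun s => a s * - u s) = (fun s => -1 * (a s * u s)).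
  by apply/funext => s; rewrite mulrN mulN1r.
have intN s : \int[mu]_(x in `[t0, s]) (a x * - u x) =
    - \int[mu]_(x in `[t0, s]) (a x * u x).
  by rewrite auN RintegralZl// mulN1r.
have NIC : - I <= C.
  rewrite -intN; apply: Rintegral_le_of_sum_le => // [s|s t0s].
    rewrite auN (_ : _ \o _ = (fun x => (-1)%:E * (a x * u x)%:E)%E)//.
    exact: integrableZl.
  rewrite intN -opprD; have := uC _ t0s.
  by rewrite -normrN ler_norml => /andP[].
(* Here [u t = (u t + I) - I], and both terms have absolute value at most [C]. *)
rewrite -[u t](addrK I) mulr2n (le_trans (ler_normB _ _))// lerD// ?uC//.
by rewrite ler_norml lerNl NIC.
Qed.

End scalar_bound.

Lemma normr_coord_le_euclidean_norm (R : realType) (n : nat) (x : 'rV[R]_n) i :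
  `|x ord0 i| <= euclidean_norm x.
Proof.
rewrite -sqrtr_sqr ler_wsqrtr// (bigD1 i)//= lerDl.
by apply: sumr_ge0 => j _; exact: sqr_ge0.
Qed.

Theorem lemma6 (R : realType) (n : nat) (t0 C : R)
    (g : R -> 'rV[R]_n) (a : R -> R)
    (t0_gt0 : 0 < t0) (C_ge0 : 0 <= C)
    (g_cont : {within `[t0, +oo[, continuous g})
    (a_cont : {within `[t0, +oo[, continuous a})
    (a_ge0 : forall t : R, t0 <= t -> 0 <= a t)
    (bound : forall t : R, t0 <= t ->
      euclidean_norm (g t + vec_integral t0 t (fun s => a s *: g s)) <= C) :
  (ereal_sup [set (euclidean_norm (g t))%:E | t in `[t0, +oo[] < +oo)%E.
Proof.
have g_le t i : t0 <= t -> `|g t ord0 i| <= C *+ 2.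
  apply: (normr_le_of_normr_sum_le C_ge0 a_ge0 (u := fun s => g s ord0 i)).
    move=> s.
    (* This covers every real [s]: for [s < t0] the segment is empty. *)
    apply: continuous_compact_integrable; first exact: segment_compact.
    apply: (@continuous_subspaceW _ _ _ `[t0, +oo[).
      by apply: subset_itvl; rewrite bnd_simp.
    move=> x; apply: cvgM; first exact: a_cont.
    apply: (@cvg_comp _ _ _ g (fun M : 'rV[R]_n => M ord0 i)).
      exact: g_cont.
    exact: coord_continuous.
  move=> s t0s.
  (* As [vec_integral] acts componentwise, coordinate [i] of the vector in [bound] is exactly the
     scalar expression required. *)
  have := le_trans (normr_coord_le_euclidean_norm _ i) (bound s t0s).
  rewrite !mxE; under eq_Rintegral do rewrite mxE.
  exact.
(* With every coordinate at most [2 C] in absolute value, the norm is at most [2 C] times the square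
   root of [n], uniformly in [t]. *)
apply: (@le_lt_trans _ _ (Num.sqrt (\sum_(i < n) (C *+ 2) ^+ 2))%:E);
  last exact: ltry.
apply: ge_ereal_sup => y [t /=]; rewrite in_itv/= andbT => t0t <-.
rewrite lee_fin ler_wsqrtr//; apply: ler_sum => i _.
by rewrite -real_normK ?num_real// lerXn2r ?nnegrE ?mulrn_wge0 ?g_le.
Qed.
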